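(* Let $L>0$ and $0<\underline\beta<\overline\beta\le 1$ be given. There exists a constant $C_*>0$, depending only on $\underline\beta$, $\overline\beta$, $L$ and the constant $\eta$ bounding $F_X$ and $\sigma$, such that the following holds. Let $\alpha\in(0,1)$ and let $\phi_n$ be any sequence of tests, where $\phi_n$ maps the data $\{(X_i,Y_i)\}_{i=1}^n$ to a rejection probability in $[0,1]$, with asymptotic level $\alpha$ for the null hypothesis that $g(x)=0$ for all $x\in\mathrm{supp}(X_1)$, that is, $\limsup_{n} E_0\phi_n\le\alpha$. Then $$\limsup_{n\to\infty}\ \inf_{\beta\in[\underline\beta,\overline\beta]}\ \inf_{g\in\mathcal{G}(C_*(n/\log\log n)^{-\beta/(2\beta+1)},L,\beta)\cap\mathcal{G}_{|x|\downarrow}} E_g\phi_n\le\alpha .$$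
   Context: Model: for each $n$ (with $n\ge 3$, so that $\log\log n>0$) one observes i.i.d. pairs of real random variables $(X_i,Y_i)$, $i=1,\dots,n$, with $Y_i=g(X_i)+\varepsilon_i$, $\varepsilon_i\mid X_i\sim N(0,\sigma^2(X_i))$, $X_i\sim F_X$, where $F_X$ is a c.d.f. and $g:\mathbb{R}\to\mathbb{R}$ is the regression function. The distribution $F_X$ and the conditional variance function $\sigma^2$ are fixed and known, and for some $\eta>0$ they satisfy $$\eta t\le |F_X(t)-F_X(-t)|\le t/\eta,\qquad \eta\le\sigma^2(x)\le 1/\eta\qquad\text{for all } |x|<\eta,\ 0<t<\eta.$$ The point $0$ may be on the boundary of the support of $X_i$. $P_g$ and $E_g$ denote probability and expectation when the regression function is $g$; $E_0$ is the case $g\equiv 0$. $\mathrm{supp}(X_1)$ is the support of $F_X$. For $L>0$ and $0\le\beta\le1$, $\Sigma(L,\beta)=\{g:\ |g(x)-g(x')|\le L|x-x'|^\beta \text{ for all } x,x'\}$. For $b\in\mathbb{R}$, $\mathcal{G}(b,L,\beta)=\{g:\ g(0)\ge b \text{ and } g\in\Sigma(L,\beta)\}$. $\mathcal{G}_{|x|\downarrow}$ is the class of functions that are nondecreasing on $(-\infty,0]$ and nonincreasing on $[0,\infty)$. *)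

(* Defs.v *)
From HB Require Import structures.
From mathcomp Require Import all_boot all_order all_algebra.
From mathcomp Require Import all_classical all_reals all_analysis.
From mathcomp Require Import measurable_realfun.

Set Implicit Arguments.
Unset Strict Implicit.
Unset Printing Implicit Defensive.

Import Order.TTheory GRing.Theory Num.Theory.
Import numFieldNormedType.Exports.

Local Open Scope classical_set_scope.
Local Open Scope ring_scope.

Section FunctionClasses.
Context {R : realType}.
Implicit Types (L beta b : R).

Definition holder_class L beta : set (R -> R) :=
  [set g | forall x x', `|g x - g x'| <= L * `|x - x'| `^ beta].

Definition holder_class_ge b L beta : set (R -> R) :=
  [set g | b <= g 0 /\ holder_class L beta g].

Definition unimodal_at0 : set (R -> R) :=
  [set g | (forall x x', x <= x' -> x' <= 0 -> g x <= g x') /\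
           (forall x x', 0 <= x -> x <= x' -> g x' <= g x)].

(* Hence restricting the regression functions to measurable ones, for which
   data_law below is a probability, loses nothing in holder_class when
   0 < beta. *)
Lemma holder_class_measurable L beta g :
  0 < beta -> holder_class L beta g -> measurable_fun [set: R] g.
Proof.
move=> b0 hg; apply: continuous_measurable_fun => x.
apply/cvgrPdist_lt => e e0.
have L1 : 0 < `|L| + 1 by rewrite ltr_wpDl.
pose q := e / (`|L| + 1).
have q0 : 0 < q by rewrite divr_gt0.
have d0 : 0 < q `^ beta^-1 by rewrite powR_gt0.
near=> y.
have yx : `|x - y| < q `^ beta^-1.
  near: y; have /cvgrPdist_lt : id @ x --> (x : R) by exact: cvg_id.
  by apply.
apply: le_lt_trans (hg x y) _.
apply: (@le_lt_trans _ _ ((`|L| + 1) * `|x - y| `^ beta)).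
  by rewrite ler_wpM2r ?powR_ge0// ler_wpDr// ler_norm.
rewrite -ltr_pdivlMl// mulrC -/q.
have -> : q = (q `^ beta^-1) `^ beta.
  by rewrite -powRrM mulVf ?gt_eqF// powRr1// ltW.
by rewrite gt0_ltr_powR// nnegrE// ltW.
Unshelve. all: by end_near. Qed.

End FunctionClasses.

Section Gaussian.
Context {R : realType}.
Local Notation TR := (measurableTypeR R).

(* N(m, v), parametrised by its variance; degenerate (Dirac) if v is zero.
   The library's normal_prob takes the standard deviation and is not a
   Gaussian at standard deviation 0. *)
Definition gaussian (m v : R) : probability TR R :=
  if 0 < v then normal_prob m (Num.sqrt v) : probability TR R
  else @dirac _ TR m R : probability TR R.

Let measurable_inv d (T : measurableType d) (f : T -> R) :
  (forall x, 0 <= f x) -> measurable_fun setT f ->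
  measurable_fun setT (fun x => (f x)^-1).
Proof.
move=> f0 mf; have -> : (fun x => (f x)^-1) = (@powR R ^~ (-1)) \o f.
  by apply/funext => x /=; rewrite powR_inv1.
exact: measurableT_comp.
Qed.

Let measurable_mulrn d (T : measurableType d) (f : T -> R) n :
  measurable_fun setT f -> measurable_fun setT (fun x => f x *+ n).
Proof. by move=> mf; apply: (measurableT_comp (natmul_measurable n)). Qed.

Let measurable_sqrt : measurable_fun [set: R] (@Num.sqrt R).
Proof. by apply: continuous_measurable_fun; exact: sqrt_continuous. Qed.

Lemma measurable_normal_prob (m s : TR -> R) (U : set TR) :
  measurable_fun setT m -> measurable_fun setT s -> measurable U ->
  measurable_fun setT (fun x => normal_prob (m x) (s x) U).
Proof.
move=> mm ms mU; rewrite /normal_prob.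
pose f (z : TR * TR) := (normal_pdf (m z.1) (s z.1) z.2 * \1_U z.2)%:E.
have -> : (fun x => \int[lebesgue_measure]_(y in U)
    (normal_pdf (m x) (s x) y)%:E)%E =
  (fun x => \int[lebesgue_measure]_y f (x, y))%E.
  apply/funext => x; rewrite integral_mkcond; apply: eq_integral => y _.
  rewrite restrict_EFin/= /f/= patchE indicE.
  by case: ifP => _; rewrite ?mulr1 ?mulr0.
apply: (@measurable_fun_fubini_tonelli_F _ _ TR TR R lebesgue_measure f);
  last first.
  by move=> z; rewrite /f/= lee_fin mulr_ge0// normal_pdf_ge0.
have mm1 : measurable_fun setT (fun z : TR * TR => m z.1).
  exact: measurableT_comp.
have ms1 : measurable_fun setT (fun z : TR * TR => s z.1).
  exact: measurableT_comp.
apply/measurable_EFinP/measurable_funM; last first.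
  by apply: measurableT_comp => //; exact: measurable_indic.
rewrite /normal_pdf; apply: measurable_fun_ifT.
- by apply: measurable_fun_eqr.
- by apply: measurableT_comp => //; exact: measurable_indic.
- apply: measurable_funM.
  + apply: measurable_inv => [z|]; first exact: sqrtr_ge0.
    apply: measurableT_comp => //; apply: measurable_mulrn.
    by apply: measurable_funM => //; exact: measurable_funX.
  + apply: measurableT_comp => //; apply: measurable_funM.
      apply: measurableT_comp => //; apply: measurable_funX.
      by apply: measurable_funB => //; exact: measurable_snd.
    apply: measurable_inv => [z|]; first by rewrite mulrn_wge0// sqr_ge0.
    by apply: measurable_mulrn; exact: measurable_funX.
Qed.

Definition gaussian_kernel (g v : {mfun TR >-> R}) :
  TR -> {measure set TR -> \bar R} := fun x => gaussian (g x) (v x).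

Lemma measurable_gaussian_kernel (g v : {mfun TR >-> R}) (U : set TR) :
  measurable U -> measurable_fun setT (gaussian_kernel g v ^~ U).
Proof.
move=> mU.
have -> : gaussian_kernel g v ^~ U = fun x => if 0 < v x then
    normal_prob (g x) (Num.sqrt (v x)) U else (\1_U (g x))%:E.
  by apply/funext => x; rewrite /gaussian_kernel /gaussian; case: ifP.
apply: measurable_fun_ifT.
- exact: measurable_fun_ltr.
- apply: measurable_normal_prob => //.
  by apply: (measurableT_comp measurable_sqrt).
- by apply/measurable_EFinP; apply: measurableT_comp => //.
Qed.

HB.instance Definition _ (g v : {mfun TR >-> R}) :=
  isKernel.Build _ _ TR TR R (gaussian_kernel g v)
    (@measurable_gaussian_kernel g v).

Lemma gaussian_kernelT (g v : {mfun TR >-> R}) x :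
  gaussian_kernel g v x setT = 1%E.
Proof. exact: probability_setT. Qed.

HB.instance Definition _ (g v : {mfun TR >-> R}) :=
  Kernel_isProbability.Build _ _ TR TR R (gaussian_kernel g v)
    (@gaussian_kernelT g v).

End Gaussian.

Section PairLaw.
Context {d d' : measure_display} {S : measurableType d} {T : measurableType d'}
  {R : realType}.
Variables (P : probability S R) (k : R.-pker S ~> T).
Local Open Scope ereal_scope.

(* The law of (X, Y) when X has law P and Y has conditional law k x given
   X = x. *)
Definition semidirect (A : set (S * T)) : \bar R :=
  \int[P]_x k x (xsection A x).

Let semidirect0 : semidirect set0 = 0.
Proof. by rewrite /semidirect integral0_eq// => x _; rewrite xsection0. Qed.

Let semidirect_ge0 A : 0 <= semidirect A.
Proof. exact: integral_ge0. Qed.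

Let semidirect_sigma_additive : semi_sigma_additive semidirect.
Proof.
move=> F mF tF mUF.
rewrite [X in _ --> X](_ : _ = \sum_(n <oo) semidirect (F n)).
  by apply/cvg_closeP; split; [exact: is_cvg_nneseries|rewrite closeE].
rewrite -integral_nneseries//; last first.
  by move=> n; apply: measurable_fun_xsection_finite_kernel; rewrite inE.
apply: eq_integral => x _; apply/esym/cvg_lim => //=; rewrite xsection_bigcup.
apply: (measure_sigma_additive _ (trivIset_xsection tF)) => ?.
exact: measurable_xsection.
Qed.

HB.instance Definition _ := isMeasure.Build _ _ _ semidirect
  semidirect0 semidirect_ge0 semidirect_sigma_additive.

Let semidirectT : semidirect setT = 1.
Proof.
rewrite /semidirect (eq_integral (cst 1)).
  by rewrite integral_cst// mul1e; exact: probability_setT.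
move=> x _; rewrite (_ : xsection _ _ = setT) ?prob_kernel//.
by apply/seteqP; split => // y _; rewrite /xsection/= inE.
Qed.

HB.instance Definition _ :=
  Measure_isProbability.Build _ _ R semidirect semidirectT.

End PairLaw.

Section IidLaw.
Context {d : measure_display} {T : measurableType d} {R : realType}.

Definition tuple_cons n (z : T * n.-tuple T) : n.+1.-tuple T :=
  [tuple of z.1 :: z.2].

Lemma measurable_tuple_cons n : measurable_fun setT (@tuple_cons n).
Proof. exact: measurable_cons. Qed.

HB.instance Definition _ n := isMeasurableFun.Build _ _ _ _ (@tuple_cons n)
  (@measurable_tuple_cons n).

(* The law of n independent draws from P. *)
Fixpoint iid_law (P : probability T R) (n : nat) :
    probability (n.-tuple T) R :=
  match n with
  | 0 => \d_[tuple]
  | m.+1 => distribution (P \x iid_law P m)%E (@tuple_cons m)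
  end.

Lemma iid_law_prod (P : probability T R) n (A : 'I_n -> set T) :
  (forall i, measurable (A i)) ->
  iid_law P n [set t | forall i, A i (tnth t i)] = (\prod_(i < n) P (A i))%E.
Proof.
elim: n A => [|n IH] A mA.
  by rewrite big_ord0 /= diracE mem_set//= => -[].
rewrite big_ord_recl -(IH (fun i => A (lift ord0 i)))// -product_measure1E//.
  rewrite /= /distribution /pushforward; congr product_measure1.
  apply/seteqP; split => -[x t] /=.
    move=> Axt; split; first exact: Axt ord0.
    by move=> i; have := Axt (lift ord0 i); rewrite tnthS.
  move=> [Ax At] i; case: (unliftP ord0 i) => [j ->|->]; last exact: Ax.
  by rewrite tnthS; exact: At.
have -> : [set t : n.-tuple T | forall i, A (lift ord0 i) (tnth t i)] =
    \bigcap_(i in [set: 'I_n]) ((@tnth _ T ^~ i) @^-1` A (lift ord0 i)).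
  by apply/seteqP; split => t At i; [move=> _; exact: At|exact: (At i I)].
apply: fin_bigcap_measurable => // i _; rewrite -[X in measurable X]setTI.
exact: measurable_tnth.
Qed.

End IidLaw.

Section Model.
Context {R : realType}.
Local Notation TR := (measurableTypeR R).

Definition design_cdf (PX : probability TR R) (t : R) : R :=
  fine (PX `]-oo, t]%classic).

Definition design_condition (eta : R) (PX : probability TR R) : Prop :=
  forall t, 0 < t < eta ->
    eta * t <= `|design_cdf PX t - design_cdf PX (- t)| <= t / eta.

Definition variance_condition (eta : R) (sigma2 : R -> R) : Prop :=
  forall x, `|x| < eta -> eta <= sigma2 x <= eta^-1.

(* P_g : the law of the sample (X_i, Y_i), i < n. *)
Definition data_law (PX : probability TR R) (sigma2 : {mfun TR >-> R})
    (n : nat) (g : {mfun TR >-> R}) : probability (n.-tuple (TR * TR)) R :=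
  iid_law (semidirect PX (gaussian_kernel g sigma2)) n.

(* Only meaningful for n >= 3: otherwise ln (ln n) <= 0 or is a junk value. *)
Definition rate (beta : R) (n : nat) : R :=
  (n%:R / ln (ln n%:R)) `^ (- (beta / (2 * beta + 1))).

End Model.

(* Main.v *)
Require Import Defs.
From HB Require Import structures.
From mathcomp Require Import all_boot all_order all_algebra.
From mathcomp Require Import all_classical all_reals all_analysis.
From mathcomp Require Import measurable_realfun ring lra.

Set Implicit Arguments.
Unset Strict Implicit.
Unset Printing Implicit Defensive.

Import Order.TTheory GRing.Theory Num.Theory.
Import numFieldNormedType.Exports.

Local Open Scope classical_set_scope.
Local Open Scope ring_scope.

(* No test can beat a mixture over M ~ (ln n)^(1/2) smoothness indices beta_i
   equally spaced in [betal, betau].  The alternative attached to beta is the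
   bump max(0, C rate - L |x|^beta).  On its support, contained in
   |x| < N^(-1/(2 beta + 1)) with N = n / ln ln n, the variance is bounded below
   and the design has mass of the order of the width, so the second moment of
   the likelihood ratio of the uniform mixture is at most the average over i, j
   of exp(K C^2 (ln ln n) N^(-|beta_i - beta_j| / 9)).  For C small the M
   diagonal terms are at most (ln n)^(1/4), hence negligible after division by
   M^2, and the others tend to 1 because N^(-1/M) decays faster than any power
   of ln n.  The mixture is thus asymptotically indistinguishable from g = 0,
   and some bump has power at most the level plus o(1). *)

(** * Integration against a measure given by a density *)

Section Density.
Context d (T : measurableType d) (R : realType).
Local Open Scope ereal_scope.
Import HBNNSimple.

(** The density is given on sets only: it passes to simple functions by linearity and to nonnegative
    functions by monotone convergence along [nnsfun_approx]. *)
Lemma ge0_integral_density (mu nu : {measure set T -> \bar R}) (h : T -> R) :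
  (forall x, (0 <= h x)%R) -> measurable_fun setT h ->
  (forall A, measurable A -> nu A = \int[mu]_(x in A) (h x)%:E) ->
  forall f : T -> \bar R, (forall x, 0 <= f x) -> measurable_fun setT f ->
  \int[nu]_x f x = \int[mu]_x (f x * (h x)%:E).
Proof.
move=> h0 mh nuE f f0 mf.
have mhE : measurable_fun setT (EFin \o h) by exact/measurable_EFinP.
pose f_ := nnsfun_approx measurableT mf.
have f_cvg x : (f_ n x)%:E @[n --> \oo] --> f x by exact: cvg_nnsfun_approx.
have indicE A : measurable A ->
    \int[mu]_x ((\1_A x)%:E * (h x)%:E) = nu A.
  move=> mA; rewrite nuE// [RHS]integral_mkcond; apply: eq_integral => x _.
  by rewrite patchE indicE; case: ifP => _; rewrite ?mul1e ?mul0e.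
have step n : \int[nu]_x (f_ n x)%:E = \int[mu]_x ((f_ n x)%:E * (h x)%:E).
  under [in LHS]eq_integral do rewrite fimfunE -fsumEFin//.
  under [in RHS]eq_integral.
    move=> x _; rewrite fimfunE -fsumEFin// ge0_mule_fsuml; last first.
      by move=> r; rewrite EFinM nnfun_muleindic_ge0.
    under eq_fsbigr do rewrite EFinM -muleA.
    over.
  rewrite ge0_integral_fsum//; last 2 first.
  - by move=> r; exact/measurable_EFinP/measurableT_comp.
  - by move=> r z _; rewrite EFinM nnfun_muleindic_ge0.
  rewrite ge0_integral_fsum//; last 2 first.
  - move=> r; apply: measurable_funeM; apply: emeasurable_funM => //.
    exact/measurable_EFinP.
  - move=> r z _; rewrite muleA mule_ge0 ?lee_fin//.
    by rewrite -lee_fin EFinM nnfun_muleindic_ge0.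
  apply: eq_fsbigr => r _.
  (* A nonnegative simple function has an empty preimage at a negative [r]; for [0 <= r] the
     constant comes out of both integrals. *)
  have [r0|r0] := leP 0%R r; last first.
    rewrite preimage_nnfun0// indic0/= !integral0_eq// => x _.
    - by rewrite mul0e mule0.
    - by rewrite mulr0.
  under eq_integral do rewrite EFinM.
  rewrite !ge0_integralZl//.
  - by rewrite indicE// integral_indic// setIT.
  - by apply: emeasurable_funM => //; exact/measurable_EFinP.
  - by move=> x _; rewrite mule_ge0// lee_fin.
  - exact/measurable_EFinP.
transitivity (limn (fun n => \int[nu]_x (f_ n x)%:E)).
  rewrite -monotone_convergence//.
  - by apply: eq_integral => x _; apply/esym/cvg_lim.
  - by move=> n; exact/measurable_EFinP.
  - by move=> n x _; rewrite lee_fin.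
  - by move=> x _ a b ab; rewrite lee_fin; exact/lefP/nd_nnsfun_approx.
under eq_fun do rewrite step.
rewrite -monotone_convergence//.
- apply: eq_integral => x _; apply/cvg_lim => //.
  by apply: cvgeZr => //; exact: f_cvg.
- by move=> n; apply: emeasurable_funM => //; exact/measurable_EFinP.
- by move=> n x _; rewrite mule_ge0// lee_fin.
- move=> x _ a b ab; rewrite lee_wpmul2r// ?lee_fin//.
  exact/lefP/nd_nnsfun_approx.
Qed.

End Density.

(** * Disintegration of the joint law of design and response *)

Section Semidirect.
Context d d' (S : measurableType d) (T : measurableType d') (R : realType).
Variables (P : probability S R) (k : R.-pker S ~> T).
Local Open Scope ereal_scope.

(** The conditional law of the whole pair given X = x. It makes [semidirect] a composition of
    kernels; [unit] is the trivial source which that composition starts from. *)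
Let graph_kernel (z : unit * S) : {measure set (S * T) -> \bar R} :=
  measure_function_pushforward__canonical__measure_function_Measure
    (k z.2) (pair1_measurable z.2).

Let measurable_graph_kernel U :
  measurable U -> measurable_fun setT (graph_kernel ^~ U).
Proof.
move=> mU.
have -> : graph_kernel ^~ U = (fun x => k x (xsection U x)) \o snd.
  apply/funext => -[u x]; rewrite /graph_kernel /pushforward/=; congr (k x _).
  by apply/seteqP; split => y; rewrite /xsection/= inE.
apply: measurableT_comp => //.
by apply: measurable_fun_xsection_finite_kernel; rewrite inE.
Qed.

HB.instance Definition _ :=
  isKernel.Build _ _ _ _ R graph_kernel measurable_graph_kernel.

Let graph_kernelT z : graph_kernel z setT = 1.
Proof. by rewrite /graph_kernel/= /pushforward preimage_setT prob_kernel. Qed.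

HB.instance Definition _ :=
  Kernel_isProbability.Build _ _ _ _ R graph_kernel graph_kernelT.

Let cst_kernel : R.-pker unit ~> S :=
  kprobability (measurable_cst (P : pprobability S R)).

(** [semidirect] is [cst_kernel] composed with [graph_kernel], so the integral formula for composed
    kernels applies; the inner integral is a pushforward along y |-> (x, y). *)
Lemma ge0_integral_semidirect (f : S * T -> \bar R) :
  (forall z, 0 <= f z) -> measurable_fun setT f ->
  \int[semidirect P k]_z f z = \int[P]_x \int[k x]_y f (x, y).
Proof.
move=> f0 mf; have := integral_kcomp cst_kernel graph_kernel tt f0 mf.
rewrite (_ : (\int[_]_z f z) = \int[semidirect P k]_z f z); last first.
  apply: eq_measure_integral => A mA _.
  rewrite /kcomp/= /semidirect; apply: eq_integral => x _ /=.
  rewrite /graph_kernel /pushforward/=; congr (k x _).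
  by apply/seteqP; split => y; rewrite /xsection/= inE.
move=> ->; apply: eq_integral => x _.
by rewrite /graph_kernel/= ge0_integral_pushforward.
Qed.

End Semidirect.

(** * Integration over n independent draws *)

Section Iid.
Context d (T : measurableType d) (R : realType).
Local Open Scope ereal_scope.
Implicit Types P Q : probability T R.

Lemma ge0_integral_iid_lawS P n (f : n.+1.-tuple T -> \bar R) :
  (forall t, 0 <= f t) -> measurable_fun setT f ->
  \int[iid_law P n.+1]_t f t =
  \int[P]_x \int[iid_law P n]_t f [tuple of x :: t].
Proof.
move=> f0 mf /=.
rewrite ge0_integral_pushforward//= fubini_tonelli1//=.
by apply: measurableT_comp => //; exact: measurable_tuple_cons.
Qed.

Lemma integral_iid_law0 P (f : 0.-tuple T -> \bar R) :
  measurable_fun setT f -> \int[iid_law P 0]_t f t = f [tuple].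
Proof. by move=> mf; rewrite integral_dirac// diracT mul1e. Qed.

Lemma measurable_prod_tnth n (w : T -> R) : measurable_fun setT w ->
  measurable_fun setT (fun t : n.-tuple T => (\prod_(i < n) w (tnth t i))%R).
Proof.
move=> mw; apply: measurable_prod => i _.
by apply: measurableT_comp => //; exact: measurable_tnth.
Qed.

Lemma measurable_cons_tuple n (x : T) :
  measurable_fun setT (fun t : n.-tuple T => [tuple of x :: t]).
Proof. exact: measurable_cons. Qed.

Lemma prod_tnth_cons n (w : T -> R) x (t : n.-tuple T) :
  (\prod_(i < n.+1) w (tnth [tuple of x :: t] i) =
   w x * \prod_(i < n) w (tnth t i))%R.
Proof.
rewrite big_ord_recl; congr (_ * _)%R.
by apply: eq_bigr => i _; rewrite tnthS.
Qed.

(** Independence, by induction with Tonelli. Applied to a product of two likelihood ratios, it makes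
    the second moment over a sample an n-th power. *)
Lemma integral_iid_law_prod P n (w : T -> R) (c : R) :
  (forall x, (0 <= w x)%R) -> measurable_fun setT w ->
  \int[P]_x (w x)%:E = c%:E ->
  \int[iid_law P n]_t (\prod_(i < n) w (tnth t i))%:E = (c ^+ n)%:E.
Proof.
move=> w0 mw wc; elim: n => [|n IH].
  rewrite integral_iid_law0; first by rewrite big_ord0.
  by apply/measurable_EFinP; exact: measurable_prod_tnth.
rewrite ge0_integral_iid_lawS; last 2 first.
- by move=> t; rewrite lee_fin prodr_ge0.
- by apply/measurable_EFinP; exact: measurable_prod_tnth.
under eq_integral.
  move=> x _; under eq_integral do rewrite prod_tnth_cons EFinM.
  rewrite ge0_integralZl//=; last 3 first.
  - by apply/measurable_EFinP; exact: measurable_prod_tnth.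
  - by move=> t _; rewrite lee_fin prodr_ge0.
  - by rewrite lee_fin.
  rewrite IH; over.
rewrite ge0_integralZr//=; first by rewrite wc -EFinM exprS.
- exact/measurable_EFinP.
- by move=> x _; rewrite lee_fin.
- rewrite lee_fin exprn_ge0// -lee_fin -wc.
  by apply: integral_ge0 => x _; rewrite lee_fin.
Qed.

(** Densities multiply under independence. The hypothesis speaks of integrals rather than sets
    because the induction applies it to a partial integral over the last coordinates. *)
Lemma ge0_integral_iid_law_density P Q (w : T -> R) :
  (forall x, (0 <= w x)%R) -> measurable_fun setT w ->
  (forall f : T -> \bar R, (forall x, 0 <= f x) -> measurable_fun setT f ->
    \int[Q]_x f x = \int[P]_x (f x * (w x)%:E)) ->
  forall n (f : n.-tuple T -> \bar R),
  (forall t, 0 <= f t) -> measurable_fun setT f ->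
  \int[iid_law Q n]_t f t =
  \int[iid_law P n]_t (f t * (\prod_(i < n) w (tnth t i))%:E).
Proof.
move=> w0 mw QP; elim => [|n IH] f f0 mf.
  rewrite !integral_iid_law0//; first by rewrite big_ord0 mule1.
  apply: emeasurable_funM => //.
  by apply/measurable_EFinP; exact: measurable_prod_tnth.
have mprod : measurable_fun setT
    (fun t : n.+1.-tuple T => (\prod_(i < n.+1) w (tnth t i))%:E).
  by apply/measurable_EFinP; exact: measurable_prod_tnth.
rewrite !ge0_integral_iid_lawS//; last 2 first.
- by move=> t; rewrite mule_ge0// lee_fin prodr_ge0.
- exact: emeasurable_funM.
have mfc x : measurable_fun setT (fun t : n.-tuple T => f [tuple of x :: t]).
  by apply: measurableT_comp => //; exact: measurable_cons_tuple.
(* For [x] fixed, [IH] changes the law of the last [n] coordinates; [QP] then changes that of the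
   first. *)
under eq_integral do rewrite IH//.
rewrite QP; last 2 first.
- move=> x; apply: integral_ge0 => t _.
  by rewrite mule_ge0// lee_fin prodr_ge0.
- apply: (@measurable_fun_fubini_tonelli_F _ _ _ _ R (iid_law P n)
    (fun z => f (tuple_cons z) * (\prod_(i < n) w (tnth z.2 i))%:E));
      last first.
    by move=> z; rewrite mule_ge0// lee_fin prodr_ge0.
  apply: emeasurable_funM.
    by apply: measurableT_comp => //; exact: measurable_tuple_cons.
  apply/measurable_EFinP.
  exact: (measurableT_comp (measurable_prod_tnth mw) measurable_snd).
apply: eq_integral => x _; rewrite -ge0_integralZr//.
- apply: eq_integral => t _.
  by rewrite prod_tnth_cons EFinM -muleA [X in _ * X]muleC.
- apply: emeasurable_funM => //.
  by apply/measurable_EFinP; exact: measurable_prod_tnth.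
- by move=> t _; rewrite mule_ge0// lee_fin prodr_ge0.
- by rewrite lee_fin.
Qed.

End Iid.

(** * Gaussian shifts with a common variance *)

Section GaussianLikelihoodRatio.
Context (R : realType).
Local Notation TR := (measurableTypeR R).
Implicit Types (m v y : R).

(** For [0 < v], the density of N(m, v) with respect to N(0, v). *)
Definition gaussian_lr m v y : R := expR ((m * y - m ^+ 2 / 2) / v).

Lemma gaussian_lr_ge0 m v y : 0 <= gaussian_lr m v y.
Proof. exact: expR_ge0. Qed.

Lemma gaussian_lr0 v y : gaussian_lr 0 v y = 1.
Proof. by rewrite /gaussian_lr mul0r expr0n mul0r subr0 mul0r expR0. Qed.

Lemma gaussian_lrM m1 m2 v y :
  gaussian_lr m1 v y * gaussian_lr m2 v y =
  expR (m1 * m2 / v) * gaussian_lr (m1 + m2) v y.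
Proof.
rewrite /gaussian_lr -!expRD; congr expR.
(* With [v^-1] abstracted the identity is polynomial in it, so no condition [v != 0] arises. *)
by move: v^-1 => w; field.
Qed.

Lemma measurable_gaussian_lr m v :
  measurable_fun [set: TR] (fun y : TR => gaussian_lr m v y).
Proof.
rewrite /gaussian_lr; apply: (measurableT_comp (@measurable_expR R)).
apply: measurable_funM => //.
by apply: measurable_funB => //; exact: measurable_funM.
Qed.

Lemma normal_pdf_lr m v y : 0 < v ->
  normal_pdf m (Num.sqrt v) y =
  normal_pdf 0 (Num.sqrt v) y * gaussian_lr m v y.
Proof.
move=> v0; have sv0 : Num.sqrt v != 0 by rewrite gt_eqF// sqrtr_gt0.
rewrite !normal_pdfE// -mulrA; congr (_ * _).
rewrite /normal_fun /gaussian_lr -expRD; congr expR.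
rewrite sqr_sqrtr ?ltW//; field.
by rewrite gt_eqF.
Qed.

Local Open Scope ereal_scope.

Lemma ge0_integral_gaussian m v (f : TR -> \bar R) : (0 < v)%R ->
  (forall y, 0 <= f y) -> measurable_fun setT f ->
  \int[gaussian m v]_y f y =
  \int[lebesgue_measure]_y (f y * (normal_pdf m (Num.sqrt v) y)%:E).
Proof.
move=> v0; apply: (@ge0_integral_density _ TR R lebesgue_measure).
- by move=> y; exact: normal_pdf_ge0.
- exact: measurable_normal_pdf.
- by move=> A mA; rewrite /gaussian v0.
Qed.

(** Where [v] is not positive both laws are Dirac masses, and a density exists only for equal means;
    hence the alternative [m = 0]. *)
Lemma ge0_integral_gaussian_lr m v (f : TR -> \bar R) : m = 0%R \/ (0 < v)%R ->
  (forall y, 0 <= f y) -> measurable_fun setT f ->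
  \int[gaussian m v]_y f y =
  \int[gaussian 0 v]_y (f y * (gaussian_lr m v y)%:E).
Proof.
case=> [->|v0] f0 mf.
  by apply: eq_integral => y _; rewrite gaussian_lr0 mule1.
rewrite (ge0_integral_gaussian m v0)// (ge0_integral_gaussian 0 v0);
  last 2 first.
- by move=> y; rewrite mule_ge0// lee_fin gaussian_lr_ge0.
- apply: emeasurable_funM => //.
  by apply/measurable_EFinP; exact: measurable_gaussian_lr.
apply: eq_integral => y _.
by rewrite normal_pdf_lr// EFinM [(normal_pdf _ _ _)%:E * _]muleC muleA.
Qed.

(** Moving to N(0, v) puts both ratios under the integral. They merge into the ratio for [m1 + m2],
    of total mass 1, times the exponential of the cross term. *)
Lemma integral_gaussian_lr m1 m2 v :
  m1 = 0%R \/ (0 < v)%R -> m2 = 0%R \/ (0 < v)%R ->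
  \int[gaussian m1 v]_y (gaussian_lr m2 v y)%:E = (expR (m1 * m2 / v))%:E.
Proof.
move=> m1P; case=> [->|v0].
  under eq_integral do rewrite gaussian_lr0.
  rewrite mulr0 mul0r expR0 integral_cst// mul1e; exact: probability_setT.
rewrite ge0_integral_gaussian_lr//; last 2 first.
- by move=> y; rewrite lee_fin gaussian_lr_ge0.
- by apply/measurable_EFinP; exact: measurable_gaussian_lr.
under eq_integral do rewrite -EFinM mulrC gaussian_lrM EFinM.
rewrite ge0_integralZl//=; last 2 first.
- by apply/measurable_EFinP; exact: measurable_gaussian_lr.
- by move=> y _; rewrite lee_fin gaussian_lr_ge0.
rewrite -[RHS]mule1; congr (_ * _).
under eq_integral do rewrite -[X in X%:E]mul1r EFinM.
rewrite -(@ge0_integral_gaussian_lr _ _ (cst 1))//; last by right.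
rewrite integral_cst// mul1e; exact: probability_setT.
Qed.

End GaussianLikelihoodRatio.

(** * Likelihood ratio of one observation *)

Section RegressionLikelihoodRatio.
Context (R : realType).
Local Notation TR := (measurableTypeR R).
Variables (PX : probability TR R) (v : {mfun TR >-> R}).
Hypothesis v_ge0 : forall x, 0 <= v x.
Implicit Type g : {mfun TR >-> R}.
Local Notation obs_law g := (semidirect PX (gaussian_kernel g v)).

(* At a point with v x = 0 this is 1, which is correct only if g x = 0; hence
   the hypothesis g x = 0 \/ 0 < v x below. *)
Definition regression_lr (g : R -> R) (z : TR * TR) : R :=
  gaussian_lr (g z.1) (v z.1) z.2.

Lemma regression_lr_ge0 (g : R -> R) z : 0 <= regression_lr g z.
Proof. exact: gaussian_lr_ge0. Qed.

Lemma measurable_regression_lr g : measurable_fun setT (regression_lr g).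
Proof.
have mg : measurable_fun setT (fun z : TR * TR => g z.1).
  exact: measurableT_comp.
have mv : measurable_fun setT (fun z : TR * TR => v z.1).
  exact: measurableT_comp.
have mvV : measurable_fun setT (fun z : TR * TR => (v z.1)^-1).
  have -> : (fun z : TR * TR => (v z.1)^-1) =
      (fun z : TR * TR => v z.1 `^ (-1)).
    by apply/funext => z; rewrite powR_inv1.
  exact: (measurableT_comp (@measurable_powR R (-1))).
rewrite /regression_lr /gaussian_lr.
apply: (measurableT_comp (@measurable_expR R)); apply: measurable_funM => //.
apply: measurable_funB; first exact: measurable_funM.
by apply: measurable_funM => //; exact: measurable_funX.
Qed.

Local Open Scope ereal_scope.

(** The design has the same law under both regression functions, so only the conditional law of the
    response changes inside the disintegration. *)
Lemma ge0_integral_regression_lr g (f : TR * TR -> \bar R) :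
  (forall x, g x = 0%R \/ (0 < v x)%R) ->
  (forall z, 0 <= f z) -> measurable_fun setT f ->
  \int[obs_law g]_z f z =
  \int[obs_law (cst 0%R)]_z (f z * (regression_lr g z)%:E).
Proof.
move=> gP f0 mf; rewrite ge0_integral_semidirect//.
rewrite (@ge0_integral_semidirect _ _ _ _ _ PX
  (gaussian_kernel (cst 0%R) v)); last 2 first.
- by move=> z; rewrite mule_ge0// lee_fin regression_lr_ge0.
- apply: emeasurable_funM => //.
  by apply/measurable_EFinP; exact: measurable_regression_lr.
apply: eq_integral => x _; rewrite ge0_integral_gaussian_lr//.
by apply: measurableT_comp => //; exact: pair1_measurable.
Qed.

(** One ratio is absorbed into the law under [g1]; given x, the Gaussian integral of the other
    remains. *)
Lemma integral_regression_lrM g1 g2 :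
  (forall x, g1 x = 0%R \/ (0 < v x)%R) ->
  (forall x, g2 x = 0%R \/ (0 < v x)%R) ->
  \int[obs_law (cst 0%R)]_z (regression_lr g1 z * regression_lr g2 z)%:E =
  \int[PX]_x (expR (g1 x * g2 x / v x))%:E.
Proof.
move=> g1P g2P; under eq_integral do rewrite mulrC EFinM.
rewrite -ge0_integral_regression_lr//; last 2 first.
- by move=> z; rewrite lee_fin regression_lr_ge0.
- by apply/measurable_EFinP; exact: measurable_regression_lr.
rewrite ge0_integral_semidirect//; last 2 first.
- by move=> z; rewrite lee_fin regression_lr_ge0.
- by apply/measurable_EFinP; exact: measurable_regression_lr.
apply: eq_integral => x _.
exact: (integral_gaussian_lr (g1P x) (g2P x)).
Qed.

End RegressionLikelihoodRatio.

(** * Second moment bound for mixtures *)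

Section Mixture.
Local Open Scope ereal_scope.

Lemma exists_le_of_sum_le (R : realDomainType) (I : finType) (a : I -> R) b :
  (0 < #|I|)%N -> (\sum_i a i <= #|I|%:R * b)%R -> exists i, (a i <= b)%R.
Proof.
move=> I0 ab; apply: contrapT => /forallNP Nab; have [i0 _] := card_gt0P I0.
have : (\sum_(i : I) b < \sum_i a i)%R.
  apply: ltr_sum; first by apply/hasP; exists i0; rewrite ?mem_index_enum.
  by move=> i _; rewrite ltNge; exact/negP/Nab.
by rewrite sumr_const -mulr_natl ltNge ab.
Qed.

(** Chi-square argument: for m the average of the [W i], the bounds [c] give E (m - 1)^2 <= e^2
    under [P], so the average power is at most the level plus [e], and some [i] does no better than
    the average. *)
Lemma mixture_second_moment d (T : measurableType d) (R : realType)
    (P : probability T R) (I : finType) (W : I -> T -> R) (phi : T -> R)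
    (e : R) (c : I -> I -> R) :
  (0 < #|I|)%N -> (0 < e)%R ->
  (forall i t, (0 <= W i t)%R) -> (forall i, measurable_fun setT (W i)) ->
  (forall i, \int[P]_t (W i t)%:E = 1) ->
  (forall i j, \int[P]_t (W i t * W j t)%:E <= (c i j)%:E) ->
  (\sum_i \sum_j c i j <= #|I|%:R ^+ 2 * (1 + e ^+ 2))%R ->
  measurable_fun setT phi -> (forall t, (0 <= phi t <= 1)%R) ->
  exists i, \int[P]_t (phi t * W i t)%:E <= \int[P]_t (phi t)%:E + e%:E.
Proof.
move=> I0 e0 W0 mW W1 Wc sumc mphi phi01.
have phi0 t : (0 <= phi t)%R by case/andP: (phi01 t).
have mphiW i : measurable_fun setT (fun t => phi t * W i t)%R.
  exact: measurable_funM.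
have mWW i j : measurable_fun setT (fun t => W i t * W j t)%R.
  exact: measurable_funM.
have intS (J : finType) (f : J -> T -> R) : (forall j t, (0 <= f j t)%R) ->
    (forall j, measurable_fun setT (f j)) ->
    \int[P]_t (\sum_j f j t)%:E = \sum_j \int[P]_t (f j t)%:E.
  move=> f0 mf; under eq_integral do rewrite -sumEFin.
  rewrite ge0_integral_sum// => [j|j t _]; last by rewrite lee_fin.
  exact/measurable_EFinP.
have intD (f h : T -> R) (x y : R) : (0 <= x)%R -> (0 <= y)%R ->
    (forall t, (0 <= f t)%R) -> (forall t, (0 <= h t)%R) ->
    measurable_fun setT f -> measurable_fun setT h ->
    \int[P]_t (x * f t + y * h t)%:E =
    x%:E * \int[P]_t (f t)%:E + y%:E * \int[P]_t (h t)%:E.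
  move=> x0 y0 f0 h0 mf mh.
  under eq_integral do rewrite EFinD !EFinM.
  rewrite ge0_integralD//; last 4 first.
  - by move=> t _; rewrite -EFinM lee_fin mulr_ge0.
  - by apply: measurable_funeM; exact/measurable_EFinP.
  - by move=> t _; rewrite -EFinM lee_fin mulr_ge0.
  - by apply: measurable_funeM; exact/measurable_EFinP.
  rewrite !ge0_integralZl//.
  - exact/measurable_EFinP.
  - by move=> t _; rewrite lee_fin.
  - exact/measurable_EFinP.
  - by move=> t _; rewrite lee_fin.
(* Integrals with a finite bound are replaced by real numbers, so that the final inequality is one
   between reals. *)
have fin_le (f : T -> R) (x : R) : (forall t, (0 <= f t)%R) ->
    \int[P]_t (f t)%:E <= x%:E -> exists2 y : R, (y <= x)%R &
    \int[P]_t (f t)%:E = y%:E.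
  move=> f0 fx; have : \int[P]_t (f t)%:E \is a fin_num.
    rewrite fin_numElt (le_lt_trans fx) ?ltry// andbT.
    apply: (@lt_le_trans _ _ 0) => //.
    by apply: integral_ge0 => t _; rewrite lee_fin.
  move=> /fineK fE; exists (fine (\int[P]_t (f t)%:E)) => //.
  by rewrite -lee_fin fE.
have [b _ bE] : exists2 b : R, (b <= 1)%R & \int[P]_t (phi t)%:E = b%:E.
  apply: fin_le => //; rewrite -(mul1e 1) -[X in _ * X](probability_setT P).
  rewrite -integral_cst//; apply: ge0_le_integral => //.
  - by move=> t _; rewrite lee_fin.
  - exact/measurable_EFinP.
  - by move=> t _; rewrite lee_fin; case/andP: (phi01 t).
have /choice[a aP] : forall i, exists x : R,
    \int[P]_t (phi t * W i t)%:E = x%:E.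
  move=> i; have [||x _ xE] := @fin_le (fun t => phi t * W i t)%R 1%R.
  - by move=> t; rewrite mulr_ge0.
  - rewrite -(W1 i); apply: ge0_le_integral => //.
    + by move=> t _; rewrite lee_fin mulr_ge0.
    + exact/measurable_EFinP.
    + exact/measurable_EFinP.
    + by move=> t _; rewrite lee_fin ler_piMl//; case/andP: (phi01 t).
  - by exists x.
suff : (\sum_i a i <= #|I|%:R * (b + e))%R.
  move=> /(exists_le_of_sum_le I0)[i ai]; exists i.
  by rewrite aP bE -EFinD lee_fin.
pose S t := (\sum_i W i t)%R.
have S0 t : (0 <= S t)%R by exact: sumr_ge0.
have mS : measurable_fun setT S by exact: measurable_sum.
set M : R := #|I|%:R; have M0 : (0 < M)%R by rewrite ltr0n.
have intSE : \int[P]_t (S t)%:E = M%:E.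
  rewrite intS//; under eq_bigr do rewrite W1.
  by rewrite sumEFin sumr_const.
have intphiS : \int[P]_t (phi t * S t)%:E = (\sum_i a i)%:E.
  under eq_integral do rewrite mulr_sumr.
  rewrite intS// => [|i t]; last by rewrite mulr_ge0.
  by rewrite -sumEFin; under eq_bigr do rewrite aP.
have intSS : \int[P]_t (S t ^+ 2)%:E <= (\sum_i \sum_j c i j)%:E.
  under eq_integral.
    move=> t _; rewrite expr2 mulr_suml.
    under eq_bigr do rewrite mulr_sumr.
    over.
  rewrite intS; last 2 first.
  - by move=> i t; apply: sumr_ge0 => j _; rewrite mulr_ge0.
  - by move=> i; exact: measurable_sum.
  rewrite -sumEFin; apply: lee_sum => i _.
  rewrite intS// => [|j t]; last by rewrite mulr_ge0.
  by rewrite -sumEFin; apply: lee_sum => j _.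
have [q qc qE] := fin_le _ _ (fun t => sqr_ge0 (S t)) intSS.
(* With m = S / M: phi (m - 1) <= e / 2 + (m - 1)^2 / (2 e), multiplied by
   2 e M^2 and arranged so that both sides are nonnegative. *)
have key : \int[P]_t (2 * e * M * (phi t * S t) + 2 * M * S t)%:E <=
    \int[P]_t (1 * (S t ^+ 2) +
      1 * (2 * e * M ^+ 2 * phi t + (e ^+ 2 + 1) * M ^+ 2 * 1))%:E.
  apply: ge0_le_integral => //.
  - by move=> t _; rewrite lee_fin addr_ge0// !mulr_ge0// ltW.
  - apply/measurable_EFinP.
    apply: measurable_funD; apply: measurable_funM => //.
    exact: measurable_funM.
  - apply/measurable_EFinP.
    apply: measurable_funD; apply: measurable_funM => //.
      exact: measurable_funX.
    by apply: measurable_funD => //; exact: measurable_funM.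
  - move=> t _; rewrite lee_fin; have /andP[p0 p1] := phi01 t.
    rewrite -subr_ge0.
    have -> : (1 * S t ^+ 2 + 1 * (2 * e * M ^+ 2 * phi t +
        (e ^+ 2 + 1) * M ^+ 2 * 1) - (2 * e * M * (phi t * S t) + 2 * M * S t) =
        (S t - M - e * M * phi t) ^+ 2 + (e * M) ^+ 2 * (1 - phi t ^+ 2))%R.
      by ring.
    rewrite addr_ge0 ?sqr_ge0// mulr_ge0 ?sqr_ge0// subr_ge0.
    by rewrite expr_le1.
move: key; rewrite intD//; last 4 first.
- by rewrite !mulr_ge0// ltW.
- by rewrite mulr_ge0// ltW.
- by move=> t; rewrite mulr_ge0.
- exact: measurable_funM.
rewrite intD//; last 4 first.
- by move=> t; exact: sqr_ge0.
- move=> t; rewrite mulr1 addr_ge0// !mulr_ge0 ?sqr_ge0 ?addr_ge0 ?sqr_ge0//.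
    exact: ltW.
- exact: measurable_funX.
- by apply: measurable_funD => //; exact: measurable_funM.
rewrite intD//; last 2 first.
- by rewrite !mulr_ge0 ?sqr_ge0// ltW.
- by rewrite mulr_ge0 ?addr_ge0 ?sqr_ge0.
rewrite intphiS intSE qE bE (_ : \int[P]_t 1%:E = 1); last first.
  by rewrite integral_cst// mul1e; exact: probability_setT.
rewrite -!EFinM -!EFinD lee_fin => key.
have eM0 : (0 < 2 * e * M)%R by rewrite !mulr_gt0.
(* Inserting q <= M^2 (1 + e^2) into [key] leaves 2 e M s <= 2 e M^2 (b + e), which is the goal. *)
rewrite -(ler_pM2l eM0); have := le_trans qc sumc; rewrite -/M => qM.
move: key qM; set s := (\sum_i a i)%R; nra.
Qed.

End Mixture.

(** * Testing g = 0 against finitely many regression functions *)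

Section RegressionMixture.
Context (R : realType).
Local Notation TR := (measurableTypeR R).
Variables (PX : probability TR R) (v : {mfun TR >-> R}).
Hypothesis v_ge0 : forall x, 0 <= v x.
Local Open Scope ereal_scope.
Local Notation obs_law g := (semidirect PX (gaussian_kernel g v)).

Definition sample_lr (g : R -> R) n (t : n.-tuple (TR * TR)) : R :=
  (\prod_(i < n) regression_lr v g (tnth t i))%R.

Lemma sample_lr_ge0 g n (t : n.-tuple (TR * TR)) : (0 <= sample_lr g t)%R.
Proof. by apply: prodr_ge0 => i _; exact: regression_lr_ge0. Qed.

Lemma measurable_sample_lr (g : {mfun TR >-> R}) n :
  measurable_fun setT (@sample_lr g n).
Proof. by apply: measurable_prod_tnth; exact: measurable_regression_lr. Qed.

Lemma expectation_sample_lr (g : {mfun TR >-> R}) n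
    (phi : {mfun n.-tuple (TR * TR) >-> R}) :
  (forall x, g x = 0%R \/ (0 < v x)%R) -> (forall t, 0 <= phi t)%R ->
  'E_(data_law PX v n g)[phi] =
  \int[data_law PX v n (cst 0%R)]_t (phi t * sample_lr g t)%:E.
Proof.
move=> gP phi0; rewrite unlock /data_law.
under [RHS]eq_integral do rewrite EFinM.
apply: (@ge0_integral_iid_law_density _ _ _ (obs_law (cst 0%R)) (obs_law g)
  (regression_lr v g)).
- by move=> z; exact: regression_lr_ge0.
- exact: measurable_regression_lr.
- by move=> f f0 mf; exact: ge0_integral_regression_lr.
- by move=> t; rewrite lee_fin.
- exact/measurable_EFinP.
Qed.

(** This is the expectation under [g] of the constant test 1, read through the change of measure. *)
Lemma integral_sample_lr (g : {mfun TR >-> R}) n :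
  (forall x, g x = 0%R \/ (0 < v x)%R) ->
  \int[data_law PX v n (cst 0%R)]_t (sample_lr g t)%:E = 1.
Proof.
move=> gP.
under eq_integral do rewrite -[sample_lr _ _]mul1r.
rewrite -(@expectation_sample_lr g n (cst 1%R) gP (fun=> ler01)).
rewrite unlock /= integral_cst// mul1e; exact: probability_setT.
Qed.

Lemma integral_sample_lrM (g1 g2 : {mfun TR >-> R}) n (c : R) :
  (forall x, g1 x = 0%R \/ (0 < v x)%R) ->
  (forall x, g2 x = 0%R \/ (0 < v x)%R) ->
  \int[PX]_x (expR (g1 x * g2 x / v x))%:E <= c%:E ->
  \int[data_law PX v n (cst 0%R)]_t (sample_lr g1 t * sample_lr g2 t)%:E <=
  (c ^+ n)%:E.
Proof.
move=> g1P g2P gc.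
have int0 : 0 <= \int[PX]_x (expR (g1 x * g2 x / v x))%:E.
  by apply: integral_ge0 => x _; rewrite lee_fin expR_ge0.
have intfin : \int[PX]_x (expR (g1 x * g2 x / v x))%:E \is a fin_num.
  by rewrite ge0_fin_numE// (le_lt_trans gc) ?ltry.
under eq_integral do rewrite -big_split/=.
rewrite (@integral_iid_law_prod _ _ _ _ n
  (fun z => regression_lr v g1 z * regression_lr v g2 z)%R
  (fine (\int[PX]_x (expR (g1 x * g2 x / v x))%:E))).
- rewrite lee_fin lerXn2r ?nnegrE//.
  + by rewrite fine_ge0.
  + by rewrite -lee_fin (le_trans int0).
  + by rewrite -lee_fin fineK.
- by move=> z; rewrite mulr_ge0 ?regression_lr_ge0.
- by apply: measurable_funM; exact: measurable_regression_lr.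
- by rewrite fineK// integral_regression_lrM.
Qed.

(** All randomness of the responses is gone from the hypotheses: what remains to estimate are
    integrals over the design. *)
Lemma exists_low_power n (I : finType) (g : I -> {mfun TR >-> R})
    (phi : {mfun n.-tuple (TR * TR) >-> R}) (e : R) (c : I -> I -> R) :
  (0 < #|I|)%N -> (0 < e)%R ->
  (forall i x, g i x = 0%R \/ (0 < v x)%R) ->
  (forall i j, \int[PX]_x (expR (g i x * g j x / v x))%:E <= (c i j)%:E) ->
  (\sum_i \sum_j c i j ^+ n <= #|I|%:R ^+ 2 * (1 + e ^+ 2))%R ->
  (forall t, (0 <= phi t <= 1)%R) ->
  exists i, 'E_(data_law PX v n (g i))[phi] <=
            'E_(data_law PX v n (cst 0%R))[phi] + e%:E.
Proof.
move=> I0 e0 gP gc sumc phi01.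
have phi0 t : (0 <= phi t)%R by case/andP: (phi01 t).
have [|||||i phi_i] := @mixture_second_moment _ _ _
  (data_law PX v n (cst 0%R)) I (fun i => @sample_lr (g i) n) phi e
  (fun i j => c i j ^+ n)%R I0 e0 _ _ _ _ sumc _ phi01.
- by move=> i t; exact: sample_lr_ge0.
- by move=> i; exact: measurable_sample_lr.
- by move=> i; exact: integral_sample_lr.
- by move=> i j; exact: integral_sample_lrM.
- exact: measurable_funP.
- by exists i; rewrite expectation_sample_lr// unlock.
Qed.

End RegressionMixture.

(** * Hoelder bumps *)

Section Bump.
Context (R : realType).
Local Notation TR := (measurableTypeR R).
Implicit Types L beta b x y : R.

(** The fractions [x / (x + y)] and [y / (x + y)] add up to 1, and each is at most its own power
    [beta] since it lies in [0, 1] and [beta <= 1]. *)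
Lemma powRD_le beta x y : 0 < beta <= 1 -> 0 <= x -> 0 <= y ->
  (x + y) `^ beta <= x `^ beta + y `^ beta.
Proof.
move=> /andP[b0 b1]; rewrite le_eqVlt => /predU1P[<- _|x0].
  by rewrite add0r powR0 ?gt_eqF// add0r.
rewrite le_eqVlt => /predU1P[<-|y0].
  by rewrite addr0 powR0 ?gt_eqF// addr0.
have s0 : 0 < x + y by rewrite addr_gt0.
have part z : 0 < z -> z <= x + y ->
    z / (x + y) * (x + y) `^ beta <= z `^ beta.
  move=> z0 zs.
  have -> : z `^ beta = (z / (x + y)) `^ beta * (x + y) `^ beta.
    by rewrite -powRM ?divr_ge0 ?ltW// divfK// gt_eqF.
  rewrite ler_wpM2r ?powR_ge0//.
  by rewrite ger1_powR// divr_gt0//= ler_pdivrMr// mul1r.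
have := lerD (part x x0 _) (part y y0 _).
rewrite -mulrDl -mulrDl divff ?gt_eqF// mul1r; apply.
- by rewrite lerDl ltW.
- by rewrite lerDr ltW.
Qed.

Lemma powR_norm_holder beta x y : 0 < beta <= 1 ->
  `| `|x| `^ beta - `|y| `^ beta | <= `|x - y| `^ beta.
Proof.
move=> beta01; have half u w : `|u| `^ beta - `|w| `^ beta <= `|u - w| `^ beta.
  rewrite lerBlDr (le_trans _ (powRD_le beta01 _ _))//.
  rewrite ge0_ler_powR ?nnegrE ?addr_ge0//; first by case/andP: beta01 => /ltW.
  by rewrite -{1}(subrK w u) ler_normD.
by rewrite ler_norml half andbT lerNl opprB distrC half.
Qed.

(** For [0 <= b], [0 <= L] and [0 < beta <= 1], the pointwise smallest nonnegative function of the
    Hoelder class with value [b] at 0. *)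
Definition holder_bump L beta b x : R := Num.max 0 (b - L * `|x| `^ beta).

Lemma holder_bump_ge0 L beta b x : 0 <= holder_bump L beta b x.
Proof. by rewrite le_max lexx. Qed.

Lemma holder_bump_le L beta b x : 0 <= L -> 0 <= b ->
  holder_bump L beta b x <= b.
Proof. by move=> L0 b0; rewrite ge_max b0 lerBlDr lerDl mulr_ge0 ?powR_ge0. Qed.

Lemma holder_bump_at0 L beta b : 0 < beta -> b <= holder_bump L beta b 0.
Proof.
move=> b0; rewrite /holder_bump normr0 powR0 ?gt_eqF// mulr0 subr0.
by rewrite le_max lexx orbT.
Qed.

Lemma holder_bump_eq0 L beta b h x : 0 <= L -> 0 <= beta -> 0 <= h ->
  b <= L * h `^ beta -> h <= `|x| -> holder_bump L beta b x = 0.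
Proof.
move=> L0 beta0 h0 bh hx; apply/max_idPl; rewrite subr_le0 (le_trans bh)//.
by rewrite ler_wpM2l// ge0_ler_powR// nnegrE.
Qed.

Lemma holder_bump_homo L beta b x y : 0 <= L -> 0 <= beta -> `|x| <= `|y| ->
  holder_bump L beta b y <= holder_bump L beta b x.
Proof.
move=> L0 beta0 xy; rewrite ge_max holder_bump_ge0/= le_max; apply/orP; right.
by rewrite lerB// ler_wpM2l// ge0_ler_powR// nnegrE.
Qed.

Lemma holder_bump_unimodal L beta b : 0 <= L -> 0 <= beta ->
  unimodal_at0 (holder_bump L beta b).
Proof.
move=> L0 beta0; split=> x y.
  move=> xy y0; apply: holder_bump_homo => //.
  by rewrite !ler0_norm ?lerN2// (le_trans xy).
move=> x0 xy; apply: holder_bump_homo => //.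
by rewrite !ger0_norm// (le_trans x0).
Qed.

(** Truncation at 0 is 1-Lipschitz, so the bound is inherited from the power function. *)
Lemma holder_bump_holder L beta b : 0 <= L -> 0 < beta <= 1 ->
  holder_class L beta (holder_bump L beta b).
Proof.
move=> L0 beta01 x y.
have maxL (u w : R) : `|Num.max 0 u - Num.max 0 w| <= `|u - w|.
  have := ler_norm (u - w); have := ler_norm (w - u); rewrite distrC ler_norml.
  by case: (leP 0 u); case: (leP 0 w) => *; apply/andP; split; lra.
apply: (le_trans (maxL _ _)).
rewrite (_ : _ - _ - _ = L * (`|y| `^ beta - `|x| `^ beta)); last by ring.
by rewrite normrM (ger0_norm L0) ler_wpM2l// distrC powR_norm_holder.
Qed.

End Bump.

(** * Design mass near 0 and the one-observation integral *)

Section DesignBound.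
Context (R : realType).
Local Notation TR := (measurableTypeR R).
Variables (PX : probability TR R) (eta : R).

(** The half-open interval is the one whose mass is exactly the increment of the c.d.f. between
    [- h] and [h]. *)
Lemma design_measure_le (h : R) : design_condition eta PX -> 0 < h < eta ->
  (PX `](- h)%R, h]%classic <= (h / eta)%:E)%E.
Proof.
move=> dPX h_eta; have /andP[h0 _] := h_eta.
have /andP[_] := dPX _ h_eta; rewrite /design_cdf => hle.
have le_Nh : - h <= h by rewrite ge0_cp// ltW.
have split_itv : `]-oo, h]%classic =
    `]-oo, (- h)%R]%classic `|` `](- h)%R, h]%classic.
  by rewrite -itv_bndbnd_setU// bnd_simp.
have fin A : measurable A -> PX A \is a fin_num.
  by move=> mA; exact: fin_num_measure.
move: hle; rewrite split_itv measureU//; last first.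
  apply/seteqP; split => // x /= [] ; rewrite !in_itv/= => xh /andP[hx _].
  by move: (lt_le_trans hx xh); rewrite ltxx.
rewrite fineD ?fin// addrC addKr => hle.
rewrite -(fineK (fin `](- h)%R, h]%classic _))// lee_fin.
exact: le_trans (ler_norm _) hle.
Qed.

(** From exp(-u) >= 1 - u, exp(u) (1 - u) <= 1, while (1 + 2 u) (1 - u) >= 1 for u in [0, 1/2]. *)
Lemma expR_le1D2x (u : R) : 0 <= u <= 1 / 2 -> expR u <= 1 + 2 * u.
Proof.
move=> /andP[u0 u1]; have u1' : 0 < 1 - u by lra.
have : expR (- u) >= 1 - u by rewrite expR_ge1Dx.
rewrite expRN => eu; have := expR_gt0 u => e0.
have : expR u * (1 - u) <= 1.
  by rewrite -ler_pdivlMl// mulr1.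
nra.
Qed.

(** Where [h <= |x|] the integrand is 1. Elsewhere the variance bound keeps the exponent below b /
    eta <= 1/2, so the exponential is linearised and the excess over 1 is weighted by the design
    mass. *)
Lemma integral_expR_le (v : {mfun TR >-> R}) (g1 g2 : {mfun TR >-> R}) b h :
  (forall x, 0 <= v x) -> design_condition eta PX -> variance_condition eta v ->
  0 < h < eta -> 0 <= b <= eta / 2 -> (forall x, 0 <= g1 x * g2 x <= b) ->
  (forall x, h <= `|x| -> g1 x * g2 x = 0) ->
  (\int[PX]_x (expR (g1 x * g2 x / v x))%:E <=
   (1 + 2 * b / eta * (h / eta))%:E)%E.
Proof.
move=> v0 dPX vv h_eta /andP[b0 b_eta] gb gh.
have /andP[h0 heta] := h_eta.
have eta0 : 0 < eta by exact: lt_trans heta.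
pose k := 2 * b / eta.
have k0 : 0 <= k by rewrite divr_ge0 ?mulr_ge0// ltW.
have mA : measurable (`](- h)%R, h]%classic : set TR) by exact: measurable_itv.
apply: (@le_trans _ _ (\int[PX]_x (1 + k * \1_(`](- h)%R, h]%classic) x)%:E)%E).
  apply: ge0_le_integral => //.
  - apply/measurable_EFinP/(measurableT_comp (@measurable_expR R)).
    apply: measurable_funM; first exact: measurable_funM.
    rewrite (_ : (fun x => (v x)^-1) = (fun x => v x `^ (-1))).
      exact: (measurableT_comp (@measurable_powR R (-1))).
    by apply/funext => x; rewrite powR_inv1.
  - apply/measurable_EFinP; apply: measurable_funD => //.
    by apply: measurable_funM => //; exact: measurable_indic.
  - move=> x _; rewrite lee_fin.
    have [hx|xh] := leP h `|x|.
      by rewrite gh// mul0r expR0 lerDl mulr_ge0.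
    have xA : x \in (`](- h)%R, h]%classic : set R).
      by rewrite inE/= in_itv/=; move: xh; rewrite ltr_norml => /andP[-> /ltW].
    rewrite indicE xA mulr1.
    have /andP[eta_v _] := vv x (lt_trans xh heta).
    have vx0 : 0 < v x by exact: lt_le_trans eta_v.
    have /andP[gb0 gb1] := gb x.
    have gv : g1 x * g2 x / v x <= b / eta.
      apply: ler_pM => //; first by rewrite invr_ge0 ltW.
      by rewrite lef_pV2// posrE.
    have gv0 : 0 <= g1 x * g2 x / v x by rewrite divr_ge0// ltW.
    apply: le_trans (expR_le1D2x _) _.
      by rewrite gv0 (le_trans gv)// ler_pdivrMr// mulrC mulrA mulr1.
    by rewrite lerD2l /k -(mulrA 2 b) ler_pM2l.
under eq_integral do rewrite EFinD EFinM.
rewrite ge0_integralD//; last 2 first.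
- by move=> x _; rewrite -EFinM lee_fin mulr_ge0.
- by apply: measurable_funeM; exact/measurable_EFinP/measurable_indic.
rewrite [X in (X + _ <= _)%E](_ : _ = 1%E); last first.
  by rewrite integral_cst// mul1e; exact: probability_setT.
rewrite ge0_integralZl//; last 1 first.
- exact/measurable_EFinP/measurable_indic.
rewrite integral_indic// setIT EFinD leeD2l// -/k (EFinM k).
rewrite lee_wpmul2l ?lee_fin//.
exact: design_measure_le.
Qed.

End DesignBound.

(** * Widths and overlaps of the bumps *)

Section Scales.
Context (R : realType).
Implicit Types N beta : R.

(** With N = n / ln ln n its power [beta] is the rate, so a bump of height C [rate] with C <= L
    vanishes beyond this distance from 0. *)
Definition bump_width beta N : R := N `^ (- (2 * beta + 1)^-1).

Lemma bump_width_gt0 beta N : 0 < N -> 0 < bump_width beta N.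
Proof. by move=> N0; rewrite powR_gt0. Qed.

Lemma rate_bump_width beta n :
  rate beta n = bump_width beta (n%:R / ln (ln n%:R)) `^ beta.
Proof.
rewrite /rate /bump_width -powRrM; congr (_ `^ _).
by rewrite mulNr [_^-1 * _]mulrC.
Qed.

Lemma bump_width_le beta N : 1 <= N -> 0 <= beta <= 1 ->
  bump_width beta N <= N `^ (- 3^-1).
Proof.
move=> N1 /andP[b0 b1]; rewrite ler_powR// lerN2 lef_pV2 ?posrE//; lra.
Qed.

Lemma bump_width_homo N b1 b2 : 1 <= N -> 0 <= b1 -> b1 <= b2 ->
  bump_width b1 N <= bump_width b2 N.
Proof.
move=> N1 b10 b12; rewrite ler_powR// lerN2 lef_pV2 ?posrE//; lra.
Qed.

(* N * height * height * (smaller width): the exponents cancel exactly when the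
   two smoothness indices agree. *)
Lemma bump_overlap N b1 b2 : 1 <= N -> 0 <= b1 -> b1 <= b2 -> b2 <= 1 ->
  N * (N `^ (- (b1 / (2 * b1 + 1))) * N `^ (- (b2 / (2 * b2 + 1))) *
    bump_width b1 N) <= N `^ (- ((b2 - b1) / 9)).
Proof.
move=> N1 b10 b12 b21; have N0 : 0 < N by exact: lt_le_trans N1.
have powRDN x y : N `^ x * N `^ y = N `^ (x + y).
  by rewrite powRD//; apply/implyP => _; rewrite gt_eqF.
rewrite -{1}(powRr1 (ltW N0)) /bump_width !powRDN ler_powR//.
have d1 : 0 < 2 * b1 + 1 by lra.
have d2 : 0 < 2 * b2 + 1 by lra.
(* The exponent on the left is -(b2 - b1) / ((2 b1 + 1) (2 b2 + 1)), and both factors are at most 3,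
   hence the 9. *)
rewrite -subr_ge0 (_ : _ - _ = (b2 - b1) *
    (9 - (2 * b1 + 1) * (2 * b2 + 1)) / (9 * (2 * b1 + 1) * (2 * b2 + 1)));
  last by field; rewrite !gt_eqF.
apply: divr_ge0; last by rewrite !mulr_ge0// ltW.
apply: mulr_ge0; first by lra.
nra.
Qed.

End Scales.

(** * Averaging the overlaps for large n *)

Section Asymptotics.
Context (R : realType).

Lemma expRN_le (x : R) : 0 < x -> expR (- x) <= x^-1.
Proof.
move=> x0; rewrite expRN lef_pV2 ?posrE ?expR_gt0//.
by rewrite (le_trans _ (expR_ge1Dx x))// lerDr.
Qed.

Lemma dist_natr_ge1 (i j : nat) : i != j -> 1 <= `|i%:R - j%:R| :> R.
Proof.
wlog ij : i j / (i < j)%N => [H|_].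
  rewrite neq_ltn => /orP[] ij; [|rewrite distrC]; apply: H => //.
    by rewrite ltn_eqF.
  by rewrite ltn_eqF.
by rewrite distrC -natrB ?(ltnW ij)// normr_nat ler1n subn_gt0.
Qed.

(** In the application s = (ln n)^(1/4) and l = ln ln n. The power of [N] is at most exp(- delta s^2
    / 36) <= 36 / (delta s^2), which beats l / 4 <= s. *)
Lemma off_diagonal_small (s l N delta : R) (M : nat) :
  0 < delta -> 2 <= s -> 0 <= l <= 4 * s -> s ^+ 4 / 2 <= ln N -> 0 < N ->
  M%:R <= 2 * s ^+ 2 -> (0 < M)%N ->
  l / 4 * N `^ (- (delta / M%:R / 9)) <= 36 / delta / s.
Proof.
move=> d0 s2 /andP[l0 ls] lnN N0 Ms M0.
have s0 : 0 < s by lra.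
have M0' : 0 < M%:R :> R by rewrite ltr0n.
rewrite /powR gt_eqF//.
have ub : delta * s ^+ 2 / 36 <= delta / M%:R / 9 * ln N.
  apply: (@le_trans _ _ (delta / (2 * s ^+ 2) / 9 * (s ^+ 4 / 2))).
    by rewrite le_eqVlt; apply/orP; left; apply/eqP; field; rewrite gt_eqF.
  apply: ler_pM => //.
  - by rewrite !divr_ge0// ?mulr_ge0 ?sqr_ge0// ltW.
  - by rewrite divr_ge0// exprn_ge0// ltW.
  - rewrite ler_pM2r ?invr_gt0// ler_pM2l// lef_pV2 ?posrE//.
    by rewrite mulr_gt0// exprn_gt0.
have x0 : 0 < delta * s ^+ 2 / 36 by rewrite divr_gt0// mulr_gt0// exprn_gt0.
have -> : 36 / delta / s = s * (delta * s ^+ 2 / 36)^-1.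
  by field; rewrite !gt_eqF.
apply: ler_pM.
- by rewrite divr_ge0.
- exact: expR_ge0.
- by rewrite ler_pdivrMr// mulrC.
- by apply: le_trans (expRN_le x0); rewrite ler_expR mulNr lerN2.
Qed.

(** The M diagonal terms equal s and contribute s / M <= 1 / s to the average; the others are at
    most 1 + 72 / (delta s). The last hypothesis makes the total excess over 1 at most e^2. *)
Lemma overlap_sum_le (s l N delta e : R) (M : nat) :
  0 < delta -> 2 <= s -> l / 4 = ln s -> s ^+ 4 / 2 <= ln N -> 1 <= N ->
  s ^+ 2 <= M%:R <= 2 * s ^+ 2 ->
  72 / delta <= s -> 1 + 72 / delta <= e ^+ 2 * s ->
  \sum_(i < M) \sum_(j < M)
    expR (l / 4 * N `^ (- (`|i%:R - j%:R| * (delta / M%:R) / 9))) <=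
  M%:R ^+ 2 * (1 + e ^+ 2).
Proof.
move=> d0 s2 lE lnN N1 /andP[sM Ms] ds es.
have s0 : 0 < s by lra.
have l0 : 0 <= l / 4 by rewrite lE ln_ge0//; lra.
have ls : l <= 4 * s by have := ln_sublinear s0; rewrite -lE; lra.
have M0 : 0 < M%:R :> R by apply: lt_le_trans sM; rewrite exprn_gt0.
have N0 : 0 < N by exact: lt_le_trans N1.
set u := 36 / delta / s.
have u0 : 0 <= u by rewrite !divr_ge0// ltW.
have u1 : u <= 1 / 2.
  by rewrite /u ler_pdivrMr//; lra.
have diag : expR (l / 4) = s by rewrite lE lnK.
have term (i j : 'I_M) :
    expR (l / 4 * N `^ (- (`|i%:R - j%:R| * (delta / M%:R) / 9))) <=
    (i == j)%:R * s + (1 + 2 * u).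
  have [->|ij] := eqVneq i j.
    rewrite subrr normr0 mul0r mul0r oppr0 powRr0 mulr1 diag mul1r lerDl.
    by rewrite addr_ge0// mulr_ge0.
  rewrite mul0r add0r; apply: le_trans (expR_le1D2x _); last first.
    by rewrite u0.
  rewrite ler_expR.
  (* Distinct indices differ by at least 1, so neighbours give the largest off-diagonal term. *)
  apply: (@le_trans _ _ (l / 4 * N `^ (- (delta / M%:R / 9)))).
    rewrite ler_wpM2l// ler_powR// lerN2 ler_pM2r ?invr_gt0//.
    apply: ler_peMl; first by rewrite divr_ge0// ltW.
    exact: (dist_natr_ge1 (ij : (i : nat) != j)).
  apply: off_diagonal_small => //; last by rewrite -(ltr0n R).
  by rewrite ls andbT; lra.
apply: (@le_trans _ _ (\sum_(i < M) (s + M%:R * (1 + 2 * u)))).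
  apply: ler_sum => i _; apply: (le_trans (ler_sum _ (fun j _ => term i j))).
  rewrite big_split/= sumr_const card_ord -[_ *+ M]mulr_natl lerD2r.
  rewrite (bigD1 i)//= eqxx mul1r big1 ?addr0// => j ji.
  by rewrite eq_sym (negbTE ji) mul0r.
rewrite sumr_const card_ord -[_ *+ M]mulr_natl expr2 -mulrA ler_pM2l//.
have uE : s * u = 36 / delta by rewrite /u mulrC divfK// gt_eqF.
have : s + M%:R * (2 * u) <= M%:R * e ^+ 2; last by lra.
apply: (@le_trans _ _ (M%:R * ((1 + 72 / delta) / s))); last first.
  by rewrite ler_pM2l// ler_pdivrMr.
have -> : (1 + 72 / delta) / s = s^-1 + 2 * u.
  by rewrite /u; field; rewrite !gt_eqF.
rewrite mulrDr lerD2r ler_pdivlMr//; nra.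
Qed.

Lemma large_sample (delta eta e : R) : 0 < delta -> 0 < eta -> 0 < e ->
  exists n0, forall n, (n0 <= n)%N ->
    let l := ln (ln n%:R) in let N := n%:R / l in
    [/\ 0 < l, 1 <= N, N `^ (- 3^-1) < eta &
      exists2 M : nat, (0 < M)%N &
      \sum_(i < M) \sum_(j < M)
        expR (l / 4 * N `^ (- (`|i%:R - j%:R| * (delta / M%:R) / 9))) <=
      M%:R ^+ 2 * (1 + e ^+ 2)].
Proof.
move=> d0 eta0 e0.
(* A sum of positive lower bounds to be met by s = (ln n)^(1/4): the middle two are those of
   [overlap_sum_le], the last makes the bumps narrower than [eta]. The threshold on n exceeds
   exp(s0^4) because s^4 = ln n. *)
pose s0 : R := 2 + 72 / delta + (1 + 72 / delta) / e ^+ 2 + 6 / eta.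
exists (Num.trunc (expR (s0 ^+ 4))).+1 => n n0 l N.
have d72 : 0 < 72 / delta by rewrite divr_gt0.
have de : 0 < (1 + 72 / delta) / e ^+ 2.
  by rewrite divr_gt0 ?addr_gt0// exprn_gt0.
have eta6 : 0 < 6 / eta by rewrite divr_gt0.
have s00 : 2 < s0 by rewrite /s0; lra.
have n_ge : expR (s0 ^+ 4) <= n%:R.
  have /ltW := truncnS_gt (expR (s0 ^+ 4)).
  by move=> /le_trans; apply; rewrite ler_nat.
have n_gt0 : 0 < n%:R :> R by apply: lt_le_trans n_ge; exact: expR_gt0.
have lnn : s0 ^+ 4 <= ln n%:R by rewrite -ler_expR lnK// posrE.
have lnn0 : 0 < ln n%:R :> R.
  by apply: lt_le_trans lnn; rewrite exprn_gt0//; lra.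
pose s := expR (l / 4).
have lE : l / 4 = ln s by rewrite /s expRK.
have s4 : s ^+ 4 = ln n%:R.
  by rewrite /s -expRM_natr divfK// /l lnK.
have s0s : s0 <= s.
  by rewrite -(@ler_pXn2r _ 4)// ?nnegrE ?s4//; [lra|exact: expR_ge0].
have s2 : 2 < s by exact: lt_le_trans s0s.
have sgt0 : 0 < s by lra.
have l0 : 0 < l.
  have : 0 < l / 4 by rewrite lE ln_gt0//; lra.
  by lra.
have N0 : 0 < N by rewrite divr_gt0.
(* ln N = s^4 - ln l with ln l <= l <= 4 s, and 4 s <= s^4 / 2 because s^3 >= 8. *)
have lnN : s ^+ 4 / 2 <= ln N.
  rewrite ln_div ?posrE// -s4.
  have : ln l <= l by rewrite ltW// ln_sublinear.
  have : l <= 4 * s by have := ln_sublinear sgt0; rewrite -lE; lra.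
  have : 8 <= s ^+ 3.
    by rewrite (_ : 8 = 2 ^+ 3)// ?ler_pXn2r ?nnegrE ?ltW//; rewrite -natrX.
  have -> : s ^+ 4 = s * s ^+ 3 by rewrite exprS.
  by nra.
have s4_ge : s <= s ^+ 4 by rewrite ler_eXnr//; lra.
have N1 : 1 <= N.
  rewrite -ler_ln ?posrE// ln1; apply: le_trans lnN.
  by lra.
split => //.
  (* N^(-1/3) <= 3 / ln N <= 6 / s^4 <= 6 / s < eta. *)
  rewrite /powR gt_eqF// mulNr.
  have x0 : 0 < 3^-1 * ln N by rewrite mulr_gt0//; lra.
  apply: le_lt_trans (expRN_le x0) _.
  rewrite -[ltRHS]invrK ltf_pV2 ?posrE ?invr_gt0//.
  have : 6 / eta < s by apply: lt_le_trans s0s; rewrite /s0; lra.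
  lra.
have [tr1 tr2] : s ^+ 2 < (Num.trunc (s ^+ 2)).+1%:R /\
    (Num.trunc (s ^+ 2))%:R <= s ^+ 2.
  by rewrite truncnS_gt truncn_le// sqr_ge0.
(* The successor gives s^2 < M <= s^2 + 1 <= 2 s^2. *)
exists (Num.trunc (s ^+ 2)).+1 => //.
apply: (@overlap_sum_le s) => //.
- exact: ltW.
- rewrite ltW//= -natr1.
  have : 1 <= s ^+ 2 by rewrite expr_ge1//; lra.
  lra.
- by apply: le_trans s0s; rewrite /s0; lra.
- rewrite -ler_pdivrMl ?exprn_gt0// mulrC.
  by apply: le_trans s0s; rewrite /s0; lra.
Qed.

End Asymptotics.

(** * Construction of the alternatives and passage to the limit *)

Lemma bump_overlap_min (R : realType) (N b1 b2 : R) :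
  1 <= N -> 0 <= b1 <= 1 -> 0 <= b2 <= 1 ->
  N * (N `^ (- (b1 / (2 * b1 + 1))) * N `^ (- (b2 / (2 * b2 + 1))) *
    Num.min (bump_width b1 N) (bump_width b2 N)) <=
  N `^ (- (`|b1 - b2| / 9)).
Proof.
move=> N1; wlog b12 : b1 b2 / b1 <= b2 => [H|] b1P b2P.
  have [b12|/ltW b21] := leP b1 b2; first exact: H.
  by rewrite [N `^ _ * _]mulrC minC distrC H.
have /andP[b10 _] := b1P; have /andP[_ b21] := b2P.
rewrite (min_idPl (bump_width_homo N1 b10 b12)) distrC ger0_norm ?subr_ge0//.
exact: bump_overlap.
Qed.

(** The bound at a fixed n. [C <= L] confines each bump to its [bump_width]; the other bounds on [C]
    keep the exponents small enough to linearise and give 2 (C / eta)^2 <= 1/4. *)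
Lemma exists_bump_low_power (R : realType) (L betal betau eta C e : R) (n : nat)
    (PX : probability (measurableTypeR R) R)
    (v : {mfun measurableTypeR R >-> R}) (M : nat)
    (phi : {mfun n.-tuple (measurableTypeR R * measurableTypeR R) >-> R}) :
  let l := ln (ln n%:R) in let N := n%:R / l in
  0 < betal -> betal < betau -> betau <= 1 -> 0 < eta ->
  0 < C -> C <= L -> C <= 1 -> C <= eta / 8 -> 0 < e ->
  (forall x, 0 <= v x) -> design_condition eta PX -> variance_condition eta v ->
  (forall t, 0 <= phi t <= 1) ->
  0 < l -> 1 <= N -> N `^ (- 3^-1) < eta -> (0 < M)%N ->
  \sum_(i < M) \sum_(j < M) expR (l / 4 *
    N `^ (- (`|i%:R - j%:R| * ((betau - betal) / M%:R) / 9))) <=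
  M%:R ^+ 2 * (1 + e ^+ 2) ->
  exists beta (g : {mfun measurableTypeR R >-> R}),
    [/\ betal <= beta <= betau,
        holder_class_ge (C * rate beta n) L beta g, unimodal_at0 g &
        ('E_(data_law PX v n g)[phi] <=
         'E_(data_law PX v n (cst 0%R))[phi] + e%:E)%E].
Proof.
move=> l N betal0 betalu betau1 eta0 C0 CL C1 Ceta e0 v0 dPX vv phi01 l0 N1.
move=> Neta M0 sumM.
have N0 : 0 < N by exact: lt_le_trans N1.
have L0 : 0 < L by exact: lt_le_trans CL.
have M0' : 0 < M%:R :> R by rewrite ltr0n.
pose step := (betau - betal) / M%:R.
have step0 : 0 < step by rewrite divr_gt0 ?subr_gt0.
pose beta (i : 'I_M) := betal + i%:R * step.
have betaP i : betal <= beta i <= betau.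
  rewrite lerDl mulr_ge0 ?(ltW step0)//= -lerBrDl /step mulrA ler_pdivrMr//.
  by rewrite mulrC ler_wpM2l ?subr_ge0 ?ltW// ltr_nat.
have beta_gt0 i : 0 < beta i.
  by have /andP[+ _] := betaP i; exact: lt_le_trans.
have beta_le1 i : beta i <= 1.
  by rewrite (le_trans _ betau1)//; case/andP: (betaP i).
have beta01 i : 0 <= beta i <= 1 by rewrite (ltW (beta_gt0 i)) beta_le1.
pose r i := rate (beta i) n.
have r_ge0 i : 0 <= r i by exact: powR_ge0.
have r_le1 i : r i <= 1.
  rewrite /r /rate -/l -/N -[leRHS](powRr0 N) ler_powR// oppr_le0.
  rewrite divr_ge0 ?ltW//.
  by rewrite addr_gt0// mulr_gt0.
pose h i := bump_width (beta i) N.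
have h_gt0 i : 0 < h i by exact: bump_width_gt0.
have h_eta i : h i < eta by apply: le_lt_trans Neta; exact: bump_width_le.
have minh_ge0 i j : 0 <= Num.min (h i) (h j) by rewrite le_min !ltW.
pose f i := holder_bump L (beta i) (C * r i).
have mf i : measurable_fun [set: measurableTypeR R] (f i).
  apply: (holder_class_measurable (beta_gt0 i)).
  apply: holder_bump_holder => //.
    exact: ltW.
  by rewrite beta_gt0 beta_le1.
pose g i : {mfun measurableTypeR R >-> R} :=
  HB.pack (f i)
    (isMeasurableFun.Build _ _ (measurableTypeR R) R (f i) (mf i)).
have f0 i x : h i <= `|x| -> f i x = 0.
  apply: holder_bump_eq0; [exact: ltW|exact: ltW|exact: ltW|].
  by rewrite /r rate_bump_width -/l -/N ler_wpM2r ?powR_ge0.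
have Cr0 i : 0 <= C * r i by rewrite mulr_ge0// ltW.
have f_le i x : 0 <= f i x <= C * r i.
  by rewrite holder_bump_ge0 holder_bump_le// ltW.
(* The bound of [integral_expR_le]: a product of two bumps is at most the product of their heights
   and lives on the narrower support. *)
pose c i j := 1 + 2 * (C * r i * (C * r j)) / eta * (Num.min (h i) (h j) / eta).
have [||||||i] := @exists_low_power _ PX v v0 n 'I_M g phi e c.
- by rewrite card_ord.
- exact: e0.
(* The variance may vanish only at distance at least [eta] from 0, where every bump is already 0. *)
- move=> i x; have [xeta|etax] := ltP `|x| eta.
    by right; have /andP[+ _] := vv _ xeta; exact: lt_le_trans.
  by left; apply: f0; rewrite ltW// (lt_le_trans (h_eta i)).
- move=> i j; apply: integral_expR_le => //.
  + by rewrite lt_min !h_gt0/= gt_min h_eta.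
  + rewrite mulr_ge0//=; apply: (@le_trans _ _ (C * 1)); last by lra.
    apply: ler_pM => //; first by rewrite ler_piMr// ltW.
    by rewrite (le_trans _ C1)// ler_piMr// ltW.
  + move=> x; have /andP[fi0 fi1] := f_le i x; have /andP[fj0 fj1] := f_le j x.
    by rewrite mulr_ge0//= ler_pM.
  + move=> x; rewrite ge_min => /orP[] /f0 /= ->; by rewrite ?mul0r ?mulr0.
- rewrite card_ord; apply: le_trans sumM.
  apply: ler_sum => i _; apply: ler_sum => j _.
  have c1 : 0 <= 2 * (C * r i * (C * r j)) / eta * (Num.min (h i) (h j) / eta).
    apply: mulr_ge0; last exact: divr_ge0 (minh_ge0 i j) (ltW eta0).
    by apply: divr_ge0 (ltW eta0); apply: mulr_ge0 => //; exact: mulr_ge0.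
  (* (1 + u)^n <= exp(n u); then n = N l separates the factor l from the overlap bounded by
     [bump_overlap_min]. *)
  apply: (@le_trans _ _ (expR (2 * (C * r i * (C * r j)) / eta *
      (Num.min (h i) (h j) / eta)) ^+ n)).
    by rewrite lerXn2r ?nnegrE ?expR_ge0 ?expR_ge1Dx// addr_ge0.
  rewrite -expRM_natr ler_expR.
  have nE : n%:R = N * l by rewrite /N divfK// gt_eqF.
  set m := Num.min _ _.
  have -> : 2 * (C * r i * (C * r j)) / eta * (m / eta) * n%:R =
      2 * (C / eta) ^+ 2 * l * (N * (r i * r j * m)).
    by rewrite nE; field; rewrite gt_eqF.
  have Ceta0 : 0 <= C / eta by rewrite divr_ge0// ltW.
  have Ceta8 : C / eta <= 1 / 8 by rewrite ler_pdivrMr//; lra.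
  apply: ler_pM.
  + by rewrite mulr_ge0 ?(ltW l0)// mulr_ge0// sqr_ge0.
  + by rewrite mulr_ge0 ?(ltW N0)// mulr_ge0 ?minh_ge0// mulr_ge0.
  + by rewrite [l / 4]mulrC ler_pM2r//; nra.
  + rewrite (_ : `|_| * _ = `|beta i - beta j|); first exact: bump_overlap_min.
    rewrite /beta -/step opprD addrACA subrr add0r -mulrBl normrM.
    by rewrite (gtr0_norm step0).
- exact: phi01.
move=> phi_i; exists (beta i), (g i); split => //.
- split; first exact: holder_bump_at0.
  by apply: holder_bump_holder; rewrite ?beta_gt0 ?beta_le1// ltW.
- by apply: holder_bump_unimodal; exact: ltW.
Qed.

(** The upper limit is an infimum, over neighbourhoods of infinity, of suprema. One almost optimal
    for [v] is intersected with the set where the comparison holds, each at the cost of e / 2. *)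
Lemma limn_esup_le_near (R : realType) (u v : (\bar R)^nat) (a : R) :
  (forall e : R, 0 < e -> \forall n \near \oo, (u n <= v n + e%:E)%E) ->
  (limn_esup v <= a%:E)%E -> (limn_esup u <= a%:E)%E.
Proof.
move=> uv va; apply/lee_addgt0Pr => e e0.
have e20 : 0 < e / 2 by rewrite divr_gt0.
have : (limn_esup v < (a + e / 2)%:E)%E.
  by apply: le_lt_trans va _; rewrite lte_fin ltrDl.
move=> /ereal_inf_lt[_ [A A_oo <-] supA].
pose B := A `&` [set n | (u n <= v n + (e / 2)%:E)%E].
apply: (@le_trans _ _ (ereal_sup (u @` B))).
  by apply: ereal_inf_lbound; exists B => //; apply: filterI => //; exact: uv.
apply: ge_ereal_sup => _ [n [An uvn] <-].
apply: (le_trans uvn); rewrite [in leRHS](splitr e) EFinD addeA leeD2r//.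
by rewrite -EFinD (le_trans _ (ltW supA))//; apply: ereal_sup_ubound; exists n.
Qed.

Theorem theorem2p1 (R : realType) (L betal betau eta : R)
    (L_gt0 : 0 < L) (betal_gt0 : 0 < betal) (betal_lt : betal < betau)
    (betau_le1 : betau <= 1) (eta_gt0 : 0 < eta) :
  exists2 C : R, 0 < C &
    forall (PX : probability (measurableTypeR R) R)
      (sigma2 : {mfun measurableTypeR R >-> R}),
    (forall x, 0 <= sigma2 x) ->
    design_condition eta PX ->
    variance_condition eta sigma2 ->
    forall (alpha : R)
      (phi : forall n,
        {mfun n.-tuple (measurableTypeR R * measurableTypeR R) >-> R}),
    0 < alpha < 1 ->
    (forall n t, 0 <= phi n t <= 1) ->
    (limn_esup (fun n => 'E_(data_law PX sigma2 n (cst 0%R))[phi n])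
       <= alpha%:E)%E ->
    (limn_esup (fun n =>
       ereal_inf [set ereal_inf
         [set 'E_(data_law PX sigma2 n g)[phi n] |
            g in [set g : {mfun measurableTypeR R >-> R} |
                    holder_class_ge (C * rate beta n) L beta g /\
                    unimodal_at0 g]] |
         beta in [set beta : R | (betal <= beta <= betau)%R]])
       <= alpha%:E)%E.
Proof.
(* The bounds on [C] required by [exists_bump_low_power], fixed before the design, the variance and
   the tests. *)
exists (Num.min L (Num.min 1 (eta / 8))).
  by rewrite !lt_min L_gt0 ltr01 divr_gt0.
set C := Num.min _ _ => PX sigma2 s0 dPX vs alpha phi alpha01 phi01.
apply: limn_esup_le_near => e e0.
(* [n0] depends on [betau - betal], [eta] and [e] only; the low-power bump is then found separately
   for each n, so it may depend on the test. *)
have [|n0 n0P] := @large_sample R (betau - betal) eta e _ eta_gt0 e0.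
  by rewrite subr_gt0.
exists n0 => // n /= /n0P[l0 N1 Neta [M M0 sumM]].
have [|||||beta [g [betaP gP1 gP2 phi_g]]] := @exists_bump_low_power R L betal
  betau eta C e n PX sigma2 M (phi n) betal_gt0 betal_lt betau_le1 eta_gt0
  _ _ _ _ e0 s0 dPX vs _ l0 N1 Neta M0 sumM.
- by rewrite !lt_min L_gt0 ltr01 divr_gt0.
- by rewrite ge_min lexx.
- by rewrite !ge_min lexx orbT.
- by rewrite !ge_min lexx !orbT.
- by move=> t; exact: phi01.
apply: le_trans phi_g.
apply: (@le_trans _ _ (ereal_inf
    [set 'E_(data_law PX sigma2 n g)[phi n] |
      g in [set g : {mfun measurableTypeR R >-> R} |
             holder_class_ge (C * rate beta n) L beta g /\ unimodal_at0 g]])%E).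
  by apply: ereal_inf_lbound; exists beta.
by apply: ereal_inf_lbound; exists g.
Qed.
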